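(* The topological group $H_+(\mathbb{S}^1)$ of all orientation preserving homeomorphisms of the circle $\mathbb{S}^1$, with the compact-open topology, is $a$-minimal.
   Context: The unit circle $\mathbb{S}^1$ (with its usual topology) is identified as a set with $[0,1)$, and carries the cyclic order $R\subseteq[0,1)^3$ given by $(z,y,x)\in R$ if and only if $(x-y)(y-z)(x-z)>0$. A homeomorphism $f:\mathbb{S}^1\to\mathbb{S}^1$ is orientation preserving if $(z,y,x)\in R$ implies $(f(z),f(y),f(x))\in R$; these form the subgroup $H_+(\mathbb{S}^1)$ of the group of all homeomorphisms of $\mathbb{S}^1$. A Hausdorff topological group is $a$-minimal if its topology is the smallest Hausdorff group topology on the underlying group (i.e. it is contained in every Hausdorff group topology on that group). *)

(* Defs.v *)
From HB Require Import structures.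
From mathcomp Require Import all_boot all_order all_algebra.
From mathcomp Require Import all_classical all_reals all_analysis.
From mathcomp Require Import ring.

Set Implicit Arguments.
Unset Strict Implicit.
Unset Printing Implicit Defensive.

Import Order.TTheory GRing.Theory Num.Theory.
Import numFieldNormedType.Exports.

Local Open Scope classical_set_scope.
Local Open Scope ring_scope.

(* A topology on [G] is an inhabitant [tau] of the class [Topological G].  The
   decidable equality and choice operator that this class also carries play no
   role: continuity and separation only depend on the open sets of [tau]. *)
Definition hausdorff_group_topology (G : groupType) (tau : Topological G) :
    Prop :=
  let T : topologicalType := Topological.Pack tau in
  [/\ continuous (fun p : T * T => ((p.1 : G) * (p.2 : G))%g : T),
      continuous (fun x : T => (x : G)^-1%g : T)
    & hausdorff_space T].

Definition a_minimal (G : groupType) (tau : Topological G) : Prop :=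
  hausdorff_group_topology tau /\
  forall sigma : Topological G, hausdorff_group_topology sigma ->
    @open (Topological.Pack tau) `<=` @open (Topological.Pack sigma).

Record homeo (X : topologicalType) := Homeo {
  homeo_fun :> X -> X;
  homeo_inv : X -> X;
  homeo_funK : cancel homeo_fun homeo_inv;
  homeo_invK : cancel homeo_inv homeo_fun;
  homeo_fun_continuous : continuous homeo_fun;
  homeo_inv_continuous : continuous homeo_inv
}.

Section HomeoGroup.
Variable X : topologicalType.
Implicit Types f g h : homeo X.

Lemma homeo_eqP f g : f = g <-> f =1 g.
Proof.
split=> [->//|fg]; case: f g fg => [f f' fK f'K cf cf'] [g g' gK g'K cg cg'].
move=> /= fg; have {}fg : f = g by exact/funext.
subst g; have ff' : f' = g' by apply/funext => x; rewrite -[x in LHS]g'K fK.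
by subst g'; congr Homeo; exact: Prop_irrelevance.
Qed.

HB.instance Definition _ := gen_eqMixin (homeo X).
HB.instance Definition _ := gen_choiceMixin (homeo X).

Definition homeo_one : homeo X :=
  @Homeo X id id (fun=> erefl) (fun=> erefl) (fun=> cvg_id) (fun=> cvg_id).

Definition homeo_opp f : homeo X :=
  Homeo (homeo_invK f) (homeo_funK f)
    (@homeo_inv_continuous X f) (@homeo_fun_continuous X f).

Lemma homeo_comp_continuous f g : continuous (f \o g).
Proof.
by move=> x; apply: continuous_comp; exact: homeo_fun_continuous.
Qed.

Lemma homeo_comp_inv_continuous f g : continuous (homeo_inv g \o homeo_inv f).
Proof.
by move=> x; apply: continuous_comp; exact: homeo_inv_continuous.
Qed.

Definition homeo_comp f g : homeo X :=
  Homeo (can_comp (homeo_funK f) (homeo_funK g))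
    (can_comp (homeo_invK g) (homeo_invK f))
    (@homeo_comp_continuous f g) (@homeo_comp_inv_continuous f g).

Fact homeo_compA : associative homeo_comp.
Proof. by move=> f g h; exact/homeo_eqP. Qed.

Fact homeo_comp1f : left_id homeo_one homeo_comp.
Proof. by move=> f; exact/homeo_eqP. Qed.

Fact homeo_compf1 : right_id homeo_one homeo_comp.
Proof. by move=> f; exact/homeo_eqP. Qed.

Fact homeo_compVf : left_inverse homeo_one homeo_opp homeo_comp.
Proof. by move=> f; apply/homeo_eqP => x /=; exact: homeo_funK. Qed.

Fact homeo_compfV : right_inverse homeo_one homeo_opp homeo_comp.
Proof. by move=> f; apply/homeo_eqP => x /=; exact: homeo_invK. Qed.

HB.instance Definition _ := isGroup.Build (homeo X)
  homeo_compA homeo_comp1f homeo_compf1 homeo_compVf homeo_compfV.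

End HomeoGroup.

Record circle (R : realType) := Circle {
  angle :> R;
  angle_itv : 0 <= angle < 1
}.

HB.instance Definition _ (R : realType) := [isSub for @angle R].
HB.instance Definition _ (R : realType) := [Choice of circle R by <:].

(* The bijection of [0, 1) onto the unit circle of the plane.  The topology that
   it induces is strictly coarser than that of [0, 1) as a subset of R: points
   close to 1 are close to 0. *)
Definition circle_point (R : realType) (t : circle R) : R * R :=
  (cos (2 * pi * angle t), sin (2 * pi * angle t)).

HB.instance Definition _ (R : realType) :=
  Topological.copy (circle R) (initial_topology (@circle_point R)).

Definition cyclic_order (R : realType) (z y x : circle R) : Prop :=
  0 < (angle x - angle y) * (angle y - angle z) * (angle x - angle z).

Definition orientation_preserving (R : realType) (f : circle R -> circle R) :
    Prop :=
  forall z y x, cyclic_order z y x -> cyclic_order (f z) (f y) (f x).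

Definition homeo_plus_pred (R : realType) : {pred homeo (circle R)} :=
  fun f => `[< orientation_preserving f >].

Record homeo_plus (R : realType) := HomeoPlus {
  homeo_plus_val :> homeo (circle R);
  homeo_plusP : homeo_plus_val \in @homeo_plus_pred R
}.

HB.instance Definition _ (R : realType) := [isSub for @homeo_plus_val R].
HB.instance Definition _ (R : realType) := [Choice of homeo_plus R by <:].

Lemma cyclic_order_total (R : realType) (z y x : circle R) :
  z <> y -> y <> x -> z <> x -> cyclic_order z y x \/ cyclic_order x y z.
Proof.
have sub_neq0 (a b : circle R) : a <> b -> angle b - angle a != 0.
  by move=> ab; rewrite subr_eq0 eq_sym; apply/eqP => /val_inj.
move=> /sub_neq0 zy /sub_neq0 yx /sub_neq0 zx; rewrite /cyclic_order.
set u := _ * _ * _; set v := _ * _ * _.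
have -> : v = - u by rewrite /u /v; ring.
have : u != 0 by rewrite !mulf_neq0.
by rewrite neq_lt oppr_gt0 => /orP[] ->; [right|left].
Qed.

Lemma cyclic_order_asym (R : realType) (z y x : circle R) :
  cyclic_order z y x -> ~ cyclic_order x y z.
Proof.
rewrite /cyclic_order.
set u := _ * _ * _; set v := _ * _ * _.
have -> : v = - u by rewrite /u /v; ring.
by rewrite oppr_gt0 => u0 /(lt_trans u0); rewrite ltxx.
Qed.

Lemma cyclic_order_neq (R : realType) (z y x : circle R) :
  cyclic_order z y x -> [/\ z <> y, y <> x & z <> x].
Proof.
rewrite /cyclic_order => zyx.
by split=> e; move: zyx; rewrite e subrr ?mulr0 ?mul0r ltxx.
Qed.

Fact homeo_plus_group_closed (R : realType) : group_closed (@homeo_plus_pred R).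
Proof.
split=> [|f g /asboolP fP /asboolP gP]; first exact/asboolP.
apply/asboolP => z y x zyx; apply: fP => /=.
have gK := @homeo_invK _ g; have ginj := can_inj gK.
have [zy yx zx] := cyclic_order_neq zyx.
have [|||//|/gP] := @cyclic_order_total _
  (homeo_inv g z) (homeo_inv g y) (homeo_inv g x).
- by move/ginj.
- by move/ginj.
- by move/ginj.
by rewrite !gK => /cyclic_order_asym.
Qed.

HB.instance Definition _ (R : realType) :=
  SubChoice_isSubGroup.Build _ _ (homeo_plus R) (@homeo_plus_group_closed R).

HB.instance Definition _ (R : realType) :=
  Topological.copy (homeo_plus R)
    (initial_topology
       (fun f : homeo_plus R => (f : {compact-open, circle R -> circle R}))).

(* Main.v *)
Require Import Defs.
From mathcomp Require Import all_boot all_order all_algebra.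
From mathcomp Require Import all_classical all_reals all_analysis.
From mathcomp Require Import ring lra.

Set Implicit Arguments.
Unset Strict Implicit.
Unset Printing Implicit Defensive.

Import Order.TTheory GRing.Theory Num.Theory.
Import numFieldNormedType.Exports.

Local Open Scope classical_set_scope.
Local Open Scope ring_scope.

(** Evaluation is jointly continuous on homeo_plus x circle for every Hausdorff
    group topology sigma, and the compact-open topology is the coarsest topology
    with this property.  Given an open arc U and f, choose noncommuting h and k
    supported in U.  The elements g such that g h g^-1 does not commute with
    f k f^-1 form a sigma-neighbourhood of f, and homeomorphisms with disjoint
    supports commute, so every such g satisfies g U `&` f U !=set0.  Using this
    for two short arcs, one on each side of a point x, orientation preservation
    traps g y between two points close to f x, for all y near x. *)

(** * Convergence in an initial topology and separation by continuous maps *)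

Lemma cvg_to_initial (S : choiceType) (T : topologicalType) (f : S -> T)
    (F : set_system S) (x : S) : Filter F ->
  f @ F --> f x -> F --> (x : initial_topology f).
Proof.
move=> FF cfF A [_ [[B oB <-] Bfx]] /filterS; apply.
by apply: cfF; exact: open_nbhs_nbhs.
Qed.

(** Clustering passes forward along continuous maps. Hence a point-separating family of continuous
    maps into Hausdorff spaces makes the source Hausdorff; this serves for the coordinates of the
    circle and for evaluations of homeomorphisms. *)
Lemma continuous_cluster_eq (S T : topologicalType) (f : S -> T) (p q : S) :
  hausdorff_space T -> continuous f -> cluster (nbhs p) q -> f p = f q.
Proof.
move=> hT cf pq; apply: hT => A B /cf fA /cf fB.
by have [z [Az Bz]] := pq _ _ fA fB; exists (f z).
Qed.

(** * The covering of the circle by the line, and the cyclic order *)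

Section Circle.
Context {R : realType}.
Implicit Types (s t u : R) (x y z : circle R).

Lemma winding_itv t : 0 <= t - (Num.floor t)%:~R < 1.
Proof.
by have := floor_itv t; rewrite intrD1 subr_ge0 ltrBlDl addrC => /andP[-> ->].
Qed.

(** The universal covering map of the circle, as the fractional part. *)
Definition winding t : circle R := Circle (winding_itv t).

Lemma windingDz t (k : int) : winding (t + k%:~R) = winding t.
Proof.
apply: val_inj => /=; rewrite floorDrz ?intr_int//.
by rewrite intrKfloor rmorphD/=; ring.
Qed.

Lemma windingD1 t : winding (t + 1) = winding t.
Proof. exact: (windingDz t 1). Qed.

Lemma winding_angle x : winding (angle x) = x.
Proof.
apply: val_inj => /=; rewrite (@floor_def _ (angle x) 0) ?subr0//.
by rewrite add0r; exact: angle_itv.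
Qed.

(** The inverse of [winding] on the fundamental domain [s, s + 1): the circle cut open at the image
    of s. The cut is a parameter so that it can be moved to suit the arc at hand. *)
Definition unwind s x : R := angle x - (Num.floor (angle x - s))%:~R.

Lemma unwind_itv s x : s <= unwind s x < s + 1.
Proof. by have := winding_itv (angle x - s); rewrite /unwind; lra. Qed.

Lemma unwindK s : cancel (unwind s) winding.
Proof. by move=> x; rewrite /unwind -mulrNz windingDz winding_angle. Qed.

Lemma windingK s t : s <= t < s + 1 -> unwind s (winding t) = t.
Proof.
move=> st; rewrite /unwind /=.
rewrite (_ : Num.floor (_ - s) = - Num.floor t) ?mulrNz; first by ring.
by apply: floor_def; rewrite rmorphD/= mulrNz; lra.
Qed.

(** With k the floor of s, each of t and u has floor k or k + 1, and t cannot pass k + 1 unless u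
    does. In the three remaining cases an even number of the three factors is negative. *)
Lemma cyclic_order_winding s t u : s < t -> t < u -> u < s + 1 ->
  cyclic_order (winding s) (winding t) (winding u).
Proof.
move=> st tu us; rewrite /cyclic_order /=; set k := Num.floor s.
have sk : k%:~R <= s < k%:~R + 1 by rewrite -intrD1 floor_itv.
have floorE r : s < r < s + 1 ->
    Num.floor r = k /\ r < k%:~R + 1 \/ Num.floor r = k + 1 /\ k%:~R + 1 <= r.
  move=> sr; case: (ltP r (k%:~R + 1)) => rk; [left|right]; split=> //.
    by apply: floor_def; rewrite intrD1; lra.
  by apply: floor_def; rewrite !intrD1; lra.
have [[-> tk]|[-> tk]] := floorE t ltac:(lra);
  have [[-> uk]|[-> uk]] := floorE u ltac:(lra); rewrite ?intrD1; try lra.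
- by rewrite !mulr_gt0//; lra.
- by rewrite nmulr_lgt0 ?nmulr_rlt0; lra.
- by rewrite nmulr_lgt0 ?pmulr_rlt0; lra.
Qed.

Lemma cyclic_order_rot z y x : cyclic_order z y x -> cyclic_order y x z.
Proof. by rewrite /cyclic_order; congr (_ < _); ring. Qed.

(** Converse of [cyclic_order_winding] on one fundamental domain: if u < t, the forward direction
    would order the triple the other way, against asymmetry. *)
Lemma cyclic_order_windingP s t u : s <= t < s + 1 -> s <= u < s + 1 ->
  cyclic_order (winding s) (winding t) (winding u) -> s < t < u.
Proof.
move=> st su stu; have [ns nt nu] := cyclic_order_neq stu.
have {}ns : s != t by apply/eqP => e; apply: ns; rewrite e.
have {}nt : t != u by apply/eqP => e; apply: nt; rewrite e.
have {}nu : s != u by apply/eqP => e; apply: nu; rewrite e.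
case: (ltgtP t u) nt => // tu _; first by lra.
have sut : cyclic_order (winding s) (winding u) (winding t).
  by apply: cyclic_order_winding; lra.
by case: (cyclic_order_asym stu); exact: cyclic_order_rot.
Qed.

(** After a cut at s, the cyclic order reads as the three rotations of a linear order; the other
    three linear orders are rotations of the reversed triple. In this form it is visibly preserved
    by increasing maps. *)
Lemma cyclic_order_unwindP s z y x :
  let a := unwind s z in let b := unwind s y in let c := unwind s x in
  cyclic_order z y x <-> [\/ a < b < c, b < c < a | c < a < b].
Proof.
rewrite /= -{1}(unwindK s z) -{1}(unwindK s y) -{1}(unwindK s x).
have := unwind_itv s x; have := unwind_itv s y; have := unwind_itv s z.
move: (unwind s z) (unwind s y) (unwind s x) => {z y x} a b c sa sb sc.
have winding_lt r t u : s <= r < s + 1 -> s <= t < s + 1 -> s <= u < s + 1 ->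
    r < t < u -> cyclic_order (winding r) (winding t) (winding u).
  by move=> *; apply: cyclic_order_winding; lra.
split=> [abc|[||]]; last 3 first.
- exact: winding_lt.
- by move/winding_lt => bca; do 2!apply: cyclic_order_rot; exact: bca.
- by move/winding_lt => cab; apply: cyclic_order_rot; exact: cab.
have [ab bc ac] := cyclic_order_neq abc.
have {}ab : a != b by apply/eqP => e; apply: ab; rewrite e.
have {}bc : b != c by apply/eqP => e; apply: bc; rewrite e.
have {}ac : a != c by apply/eqP => e; apply: ac; rewrite e.
have ncba := cyclic_order_asym abc.
case: (ltgtP a b) ab => // ab _; case: (ltgtP b c) bc => // bc _;
  case: (ltgtP a c) ac => // ac _; try by [constructor 1; lra|
    constructor 2; lra|constructor 3; lra].
- by case: ncba; apply: cyclic_order_rot; apply: winding_lt => //; lra.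
- by case: ncba; do 2!apply: cyclic_order_rot; apply: winding_lt => //; lra.
- by case: ncba; apply: winding_lt => //; lra.
Qed.

(** * Topology of the circle: Hausdorff, compact, with arcs as neighbourhoods *)

Lemma circle_point_winding t :
  circle_point (winding t) = (cos (2 * pi * t), sin (2 * pi * t)).
Proof.
have periodicz (f : R -> R) a k :
    periodic f (pi *+ 2) -> f (a - (pi *+ 2) *~ k) = f a.
  move=> fP; case: k => k.
    by rewrite -pmulrn -(periodicn fP k) subrK.
  by rewrite NegzE mulrNz opprK -pmulrn periodicn.
rewrite /circle_point /= mulrBr.
rewrite (_ : 2 * pi * (Num.floor t)%:~R = (pi *+ 2) *~ Num.floor t); last first.
  by rewrite mulrzr; congr (_ *~ _); ring.
by rewrite !periodicz//; [exact: sinD2pi|exact: cosD2pi].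
Qed.

Lemma winding_continuous : continuous winding.
Proof.
apply: continuous_comp_initial.
rewrite (_ : _ \o _ = fun t => (cos (2 * pi * t), sin (2 * pi * t))); last first.
  by apply/funext => t; exact: circle_point_winding.
have ct (f : R -> R) : continuous f -> continuous (fun t => f (2 * pi * t)).
  by move=> cf t; apply: continuous_comp; [exact: mulrl_continuous|exact: cf].
move=> t.
exact: cvg_pair (ct _ (@continuous_cos R) t) (ct _ (@continuous_sin R) t).
Qed.

(** If two angles differ, d, which is pi times their difference, lies strictly between 0 and pi, so
    sin d > 0; equal points would give cos 2d = 1, that is sin d = 0. *)
Lemma circle_point_inj : injective (@circle_point R).
Proof.
have pi0 := @pi_gt0 R.
suff wlog_lt x y : angle x < angle y -> circle_point x <> circle_point y.
  move=> x y exy; apply: val_inj => /=.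
  by case: (ltgtP (angle x) (angle y)) => // /wlog_lt; rewrite exy.
move=> xy [ec es]; have := angle_itv x; have := angle_itv y => yI xI.
pose d := pi * (angle y - angle x).
have d0 : 0 < sin d.
  apply: sin_gt0_pi; rewrite mulr_gt0 ?subr_gt0//=.
  by rewrite gtr_pMr//; lra.
have : cos (d *+ 2) = 1.
  rewrite (_ : d *+ 2 = 2 * pi * angle y - 2 * pi * angle x); last first.
    by rewrite /d mulr2n; ring.
  by rewrite cosB ec es -!expr2 cos2Dsin2.
rewrite cos_mulr2n => c1; have := cos2Dsin2 d; have := exprn_gt0 2 d0; lra.
Qed.

Lemma circle_hausdorff : hausdorff_space (circle R).
Proof.
move=> p q pq; apply: circle_point_inj.
have cts := @initial_continuous (circle R) _ (@circle_point R).
have h1 : continuous (fun x : circle R => (circle_point x).1).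
  by move=> x; apply: cvg_comp; [exact: cts|exact: cvg_fst].
have h2 : continuous (fun x : circle R => (circle_point x).2).
  by move=> x; apply: cvg_comp; [exact: cts|exact: cvg_snd].
rewrite [LHS]surjective_pairing [RHS]surjective_pairing.
by rewrite (continuous_cluster_eq _ h1 pq) ?(continuous_cluster_eq _ h2 pq)//;
  exact: Rhausdorff.
Qed.

Lemma winding_compact (A : set R) : compact A -> compact (winding @` A).
Proof.
apply: continuous_compact; apply: continuous_subspaceT.
exact: winding_continuous.
Qed.

Lemma circle_compact : compact [set: circle R].
Proof.
rewrite (_ : setT = winding @` `[0, 1]).
  exact/winding_compact/segment_compact.
apply/seteqP; split=> // x _; exists (angle x); last exact: winding_angle.
by rewrite /= in_itv /=; have := angle_itv x; lra.
Qed.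

(** With s and u lifting the endpoints, the complement is the image of the compact interval
    [u, s + 1], hence closed. *)
Lemma open_arc z x : open [set y | cyclic_order z y x].
Proof.
rewrite -(winding_angle z) -(unwindK (angle z) x).
move: (angle z) (unwind _ x) (unwind_itv (angle z) x) => s u su {z x}.
rewrite -[X in open X]setCK openC (_ : ~` _ = winding @` `[u, s + 1]).
  apply: compact_closed circle_hausdorff _.
  exact/winding_compact/segment_compact.
apply/seteqP; split=> [y /= nsyu|_ [t + <-] /=].
  have := unwind_itv s y; have := unwindK s y; set t := unwind s y => ty st.
  rewrite -ty in nsyu *; have [ut|tu] := leP u t.
    by exists t => //=; rewrite in_itv/=; lra.
  (* The base point itself lies outside the arc; it is reached through the other end s + 1 of the
     interval. *)
  have [est|nst] := eqVneq s t.
    by exists (s + 1); rewrite ?windingD1 ?est//= in_itv/= -?est; lra.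
  have {}nst : s < t by rewrite lt_neqAle nst; lra.
  by case: nsyu; apply: cyclic_order_winding; lra.
rewrite /= in_itv /= => ut /[dup] /cyclic_order_neq[nst _ _].
have nst1 : t != s + 1 by apply/eqP => e; apply: nst; rewrite e windingD1.
have {nst1} ts1 : t < s + 1 by rewrite lt_neqAle nst1; lra.
by move=> /cyclic_order_windingP; lra.
Qed.

Lemma nbhs_arc x (A : set (circle R)) : nbhs x A ->
  exists s t u, [/\ winding t = x, s < t < u, u < s + 1 &
    forall r, s <= r <= u -> A (winding r)].
Proof.
rewrite -(winding_angle x); set t := angle x => /winding_continuous /nbhs_ballP[].
(* The bound e / 2 keeps the closed arc of radius d inside the open ball; the bound 1 / 4 keeps its
   length below a full turn. *)
move=> e /= e0 eA; pose d := Num.min (e / 2) (1 / 4).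
have [d0 de d1] : [/\ 0 < d, d < e & d < 1 / 2].
  rewrite /d; split; first by rewrite lt_min; lra.
    by rewrite gt_min; apply/orP; left; lra.
  by rewrite gt_min; apply/orP; right; lra.
exists (t - d), t, (t + d); split; [by []|lra|lra|].
by move=> r rd; apply: eA; rewrite /ball /= ltr_norml; lra.
Qed.

(* winding is a closed map on [s, s + 1], hence a quotient map. *)
Lemma continuous_on_circle (X : topologicalType) s (F : circle R -> X)
    (G : R -> X) :
  continuous G -> (forall t, s <= t <= s + 1 -> F (winding t) = G t) ->
  continuous F.
Proof.
move=> /continuous_closedP cG FG; apply/continuous_closedP => C /cG cC.
rewrite (_ : _ @^-1` _ = winding @` (`[s, s + 1] `&` G @^-1` C)).
  apply: compact_closed circle_hausdorff _; apply: winding_compact.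
  by apply: compact_closedI cC; exact: segment_compact.
apply/seteqP; split=> [x /= Cx|_ [t [/= + Ct] <-]]; last first.
  by rewrite in_itv /= => st; rewrite FG.
have st := unwind_itv s x; exists (unwind s x); last exact: unwindK.
by split; rewrite /= ?in_itv/= -?FG ?unwindK//; lra.
Qed.

End Circle.

(** * Construction of homeomorphisms supported in an arc, and their commutation *)

Section HomeoPlus.
Context {R : realType}.
Implicit Types (s t u : R) (x y z : circle R) (f g h k : homeo_plus R).

Lemma homeo_plusM f g x : (f * g)%g x = f (g x).
Proof. by []. Qed.

Lemma homeo_plusK f : cancel f (f^-1)%g.
Proof. exact: homeo_funK. Qed.

Lemma homeo_plusVK f : cancel (f^-1)%g f.
Proof. exact: homeo_invK. Qed.

Lemma homeo_plus_eqP f g : f = g <-> f =1 g.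
Proof.
by split=> [->//|fg]; apply: val_inj; apply/homeo_eqP.
Qed.

Lemma homeo_plus_continuous f : continuous f.
Proof. exact: homeo_fun_continuous. Qed.

Lemma homeo_plus_cyclic_order f z y x :
  cyclic_order z y x -> cyclic_order (f z) (f y) (f x).
Proof. exact: (asboolP _ (homeo_plusP f)). Qed.

(** Fixing both s and s + 1 makes [phi] preserve the fundamental domain and agree at the two ends
    glued together, so it descends to the circle, as does its inverse [psi]. Monotonicity then gives
    preservation of the cyclic order. *)
Lemma homeo_plus_of_increasing s (phi psi : R -> R) :
  continuous phi -> continuous psi -> cancel phi psi -> cancel psi phi ->
  {homo phi : t u / t < u} -> phi s = s -> phi (s + 1) = s + 1 ->
  exists h, forall t, s <= t <= s + 1 -> h (winding t) = winding (phi t).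
Proof.
move=> cphi cpsi phiK psiK phi_lt phis phis1.
have phi_mono : {mono phi : t u / t <= u} := le_mono phi_lt.
have phi_itv t : (s <= phi t < s + 1) = (s <= t < s + 1).
  by rewrite -[in LHS]phis1 -[X in X <= _]phis phi_mono (leW_mono phi_mono).
have psi_itv t : (s <= psi t < s + 1) = (s <= t < s + 1).
  by rewrite -phi_itv psiK.
pose fn (a : R -> R) x := winding (a (unwind s x)).
have fnE a t : a s = s -> a (s + 1) = s + 1 ->
    s <= t <= s + 1 -> fn a (winding t) = winding (a t).
  move=> as_ as1 st; have [t1|t1] := ltP t (s + 1).
    by rewrite /fn windingK//; lra.
  have -> : t = s + 1 by lra.
  by rewrite as1 !windingD1 /fn windingK ?as_//; lra.
have fn_cts a : continuous a -> a s = s -> a (s + 1) = s + 1 ->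
    continuous (fn a).
  move=> ca as_ as1; apply: (@continuous_on_circle _ _ s _ (winding \o a)).
    by move=> t; apply: continuous_comp; [exact: ca|exact: winding_continuous].
  by move=> t; exact: fnE.
have psis : psi s = s by rewrite -[in LHS]phis.
have psis1 : psi (s + 1) = s + 1 by rewrite -[in LHS]phis1.
have fnK : cancel (fn phi) (fn psi).
  by move=> x; rewrite /fn windingK ?phiK ?unwindK// phi_itv unwind_itv.
have fnVK : cancel (fn psi) (fn phi).
  by move=> x; rewrite /fn windingK ?psiK ?unwindK// psi_itv unwind_itv.
pose H := Homeo fnK fnVK (fn_cts _ cphi phis phis1) (fn_cts _ cpsi psis psis1).
have Hp : H \in @homeo_plus_pred R.
  apply/asboolP => z y x /(cyclic_order_unwindP s) zyx.
  apply/(cyclic_order_unwindP s); rewrite /= !windingK ?phi_itv ?unwind_itv//.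
  by rewrite !(leW_mono phi_mono).
by exists (HomeoPlus Hp) => t; exact: fnE.
Qed.

(* Slope 2 on the first third of [s, u], slope 1/2 on the rest, and the identity
   outside [s, u], where the maximum is t. *)
Definition push s u t := Num.max t (Num.min (2 * t - s) ((t + u) / 2)).

(** The inverse of [push s u]: slope 1/2 up to (s + 2u) / 3, the image of the break point, then
    slope 2. *)
Definition pull s u t := Num.min t (Num.max ((t + s) / 2) (2 * t - u)).

Lemma pushE s u t : s < u ->
  [\/ (t <= s \/ u <= t) /\ push s u t = t,
      s <= t <= (2 * s + u) / 3 /\ push s u t = 2 * t - s |
      (2 * s + u) / 3 <= t <= u /\ push s u t = (t + u) / 2].
Proof.
move=> su; rewrite /push; have [ts|st] := leP t s.
  by constructor 1; split; [left|rewrite max_l// ge_min; apply/orP; left; lra].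
have [ut|tu] := leP u t.
  by constructor 1; split; [right|rewrite max_l// ge_min; apply/orP; right; lra].
have [tm|mt] := leP t ((2 * s + u) / 3).
  by constructor 2; split; [lra|rewrite min_l ?max_r//; lra].
by constructor 3; split; [lra|rewrite min_r ?max_r//; lra].
Qed.

Lemma pullE s u t : s < u ->
  [\/ (t <= s \/ u <= t) /\ pull s u t = t,
      s <= t <= (s + 2 * u) / 3 /\ pull s u t = (t + s) / 2 |
      (s + 2 * u) / 3 <= t <= u /\ pull s u t = 2 * t - u].
Proof.
move=> su; rewrite /pull; have [ts|st] := leP t s.
  by constructor 1; split; [left|rewrite min_l// le_max; apply/orP; left; lra].
have [ut|tu] := leP u t.
  by constructor 1; split; [right|rewrite min_l// le_max; apply/orP; right; lra].
have [tm|mt] := leP t ((s + 2 * u) / 3).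
  by constructor 2; split; [lra|rewrite max_l ?min_r//; lra].
by constructor 3; split; [lra|rewrite max_r ?min_r//; lra].
Qed.

Lemma pushK s u : s < u -> cancel (push s u) (pull s u).
Proof.
move=> su t; have := pullE (push s u t) su.
by case: (pushE t su) => -[+ ->] [] [+ ->]; lra.
Qed.

Lemma pullK s u : s < u -> cancel (pull s u) (push s u).
Proof.
move=> su t; have := pushE (pull s u t) su.
by case: (pullE t su) => -[+ ->] [] [+ ->]; lra.
Qed.

Lemma push_lt s u : s < u -> {homo push s u : t v / t < v}.
Proof.
move=> su t v.
by case: (pushE t su) => -[+ ->]; case: (pushE v su) => -[+ ->]; lra.
Qed.

Lemma push_continuous s u : continuous (push s u) /\ continuous (pull s u).
Proof.
have caff (a c : R) : continuous (fun t : R => a * t + c).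
  by move=> t; apply: cvgD; [exact: mulrl_continuous|exact: cvg_cst].
have cmax (f g : R -> R) : continuous f -> continuous g ->
    continuous (fun t => Num.max (f t) (g t)).
  by move=> cf cg t; exact: continuous_max (cf t) (cg t).
have cmin (f g : R -> R) : continuous f -> continuous g ->
    continuous (fun t => Num.min (f t) (g t)).
  by move=> cf cg t; exact: continuous_min (cf t) (cg t).
have cid : continuous (id : R -> R) by move=> x; exact: cvg_id.
have chalf (a : R) : continuous (fun t : R => (t + a) / 2).
  rewrite (_ : (fun t => _) = fun t => 2^-1 * t + a / 2) //.
  by apply/funext => t; field.
by split; [apply: cmax|apply: cmin] => //; [apply: cmin|apply: cmax];
  first [exact: chalf|exact: caff].
Qed.

Lemma exists_push s u : s < u <= s + 1 ->
  exists h, forall t, s <= t <= s + 1 -> h (winding t) = winding (push s u t).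
Proof.
move=> /andP[su us]; have [push_cts pull_cts] := push_continuous s u.
apply: homeo_plus_of_increasing push_cts pull_cts (pushK su) (pullK su)
  (push_lt su) _ _.
- by case: (pushE s su) => -[+ ->]; lra.
- by case: (pushE (s + 1) su) => -[+ ->]; lra.
Qed.

(** Take h pushing along the whole arc and k along its first half only. At the quarter point p, h
    moves p to the midpoint m, which k fixes; but k first moves p forward, and h then carries it
    strictly beyond m. *)
Lemma noncommuting_bumps s u : s < u < s + 1 ->
  exists h k, [/\ forall x, (winding @` `]s, u[) x \/ h x = x,
    forall x, (winding @` `]s, u[) x \/ k x = x & (h * k)%g <> (k * h)%g].
Proof.
move=> su; pose m := (s + u) / 2; pose p := (s + m) / 2.
have su' : s < u by lra.
have sm : s < m by rewrite /m; lra.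
have [h hE] := @exists_push s u ltac:(lra).
have [k kE] := @exists_push s m ltac:(rewrite /m; lra).
have supp v f : s < v <= u ->
    (forall t, s <= t <= s + 1 -> f (winding t) = winding (push s v t)) ->
    forall x, (winding @` `]s, u[) x \/ f x = x.
  move=> /andP[sv vu] fE x; have := unwind_itv s x; have := unwindK s x.
  set t := unwind s x => <- st; have [stu|nstu] := boolP (s < t < u).
    by left; exists t => //=; rewrite in_itv.
  right; rewrite fE; last by lra.
  by congr winding; case: (pushE t sv) => -[+ ->]; lra.
exists h, k; split.
- by apply: supp hE; lra.
- by apply: supp kE; rewrite /m; lra.
move/homeo_plus_eqP => /(_ (winding p)); rewrite !homeo_plusM.
have -> : h (winding p) = winding m.
  rewrite hE; last by rewrite /p /m; lra.
  by congr winding; case: (pushE p su') => -[+ ->]; rewrite /p /m; lra.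
have -> : k (winding p) = winding ((p + m) / 2).
  rewrite kE; last by rewrite /p /m; lra.
  by congr winding; case: (pushE p sm) => -[+ ->]; rewrite /p /m; lra.
have -> : k (winding m) = winding m.
  rewrite kE; last by rewrite /m; lra.
  by congr winding; case: (pushE m sm) => -[+ ->]; rewrite /m; lra.
rewrite hE; last by rewrite /p /m; lra.
have /andP[mr ru] : m < push s u ((p + m) / 2) < u.
  by case: (pushE ((p + m) / 2) su') => -[+ ->]; rewrite /p /m; lra.
move=> /(congr1 (unwind s)); rewrite !windingK; rewrite /m in mr *; lra.
Qed.

Lemma disjoint_support_commute (A B : set (circle R)) f h k :
  (forall x, A x \/ h x = x) -> (forall x, B x \/ k x = x) ->
  (forall x, A x -> ~ B (f x)) ->
  (f * h * f^-1 * k = k * (f * h * f^-1))%g.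
Proof.
move=> hA kB fAB; apply/homeo_plus_eqP => y; rewrite !homeo_plusM.
have fhB z : B z -> f (h ((f^-1)%g z)) = z.
  move=> Bz; have [/fAB|->] := hA ((f^-1)%g z); last exact: homeo_plusVK.
  by rewrite homeo_plusVK.
have [By|ky] := kB y.
  (* On B the conjugate of h is the identity, and k y stays in B: otherwise k would fix k y, hence y
     by injectivity. *)
  rewrite (fhB y)// fhB//; have [//|/(can_inj (homeo_plusK k)) ky] := kB (k y).
  by rewrite ky.
rewrite ky; have [|->//] := kB (f (h ((f^-1)%g y))).
(* If f (h z) lies in B, then h z is not in A, so h fixes h z and, by injectivity, z. The point f (h
   z) is then y, which k fixes. *)
set z := (f^-1)%g y => Bfhz; have [/fAB//|] := hA (h z).
move=> /(can_inj (homeo_plusK h)) hz.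
by rewrite hz /z homeo_plusVK.
Qed.

End HomeoPlus.

(** * Noncommutation as an open condition in a Hausdorff group *)

(** Both sides are continuous in g and differ at f, so disjoint neighbourhoods of the two values
    pull back to a neighbourhood of f. *)
Lemma near_noncommuting (G : groupType) (tau : Topological G) (f h k : G) :
  hausdorff_group_topology tau ->
  (f * h * f^-1 * k)%g <> (k * (f * h * f^-1))%g ->
  \forall g \near (f : Topological.Pack tau),
    (g * h * g^-1 * k)%g <> (k * (g * h * g^-1))%g.
Proof.
set T := Topological.Pack tau; move=> [cmul cinv hT].
have cM (a b : T -> T) : continuous a -> continuous b ->
    continuous (fun x : T => ((a x : G) * (b x : G))%g : T).
  move=> ca cb x.
  have cab : (a y, b y) @[y --> x] --> (a x, b x).
    exact: cvg_pair (ca x) (cb x).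
  exact: cvg_comp cab (cmul (a x, b x)).
have cst (a : T) : continuous (fun _ : T => a) by move=> ?; exact: cvg_cst.
have cid : continuous (id : T -> T) by move=> ?; exact: cvg_id.
have cconj : continuous (fun g : T => ((g : G) * h * (g : G)^-1)%g : T).
  exact: cM (cM _ _ cid (cst h)) cinv.
have cl := cM _ _ cconj (cst k); have cr := cM _ _ (cst k) cconj.
rewrite open_hausdorff in hT => /(introN (@eqP T _ _)) /hT[[A B] /=].
rewrite !inE => -[Af Bf] [oA oB AB0].
have nA := cl f _ (open_nbhs_nbhs (conj oA Af)).
have nB := cr f _ (open_nbhs_nbhs (conj oB Bf)).
near=> g => eg; suff : (A `&` B) ((g * h * g^-1 * k)%g : T) by rewrite AB0.
by split; [near: g|rewrite eg; near: g].
Unshelve. all: by end_near. Qed.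

(** * The compact-open topology as a Hausdorff group topology *)

Section HomeoPlusTopology.
Context {R : realType}.
Implicit Types (s t u : R) (x y z : circle R) (f g h k : homeo_plus R).

Lemma homeo_plus_compact_open (K O : set (circle R)) f :
  compact K -> open O -> f @` K `<=` O ->
  \forall g \near f, (g : homeo_plus R) @` K `<=` O.
Proof.
move=> cK oO fKO; have := @initial_continuous (homeo_plus R) _
  (fun f : homeo_plus R => (f : {compact-open, circle R -> circle R})).
move=> /(_ f [set g : {compact-open, circle R -> circle R} | g @` K `<=` O]).
by apply; apply: open_nbhs_nbhs; split => //; exact: compact_open_open.
Qed.

Lemma homeo_plus_cvg (F : set_system (homeo_plus R)) f : Filter F ->
  (forall K O, compact K -> open O -> f @` K `<=` O ->
    \forall g \near F, (g : homeo_plus R) @` K `<=` O) ->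
  F --> f.
Proof.
move=> FF cF; apply: cvg_to_initial; apply/compact_open_cvgP => K O cK oO fKO.
exact: cF.
Qed.

(** This rests on local compactness of the circle: f maps some compact arc around x into V, and this
    persists for all g near f and all y in the open arc. *)
Lemma homeo_plus_eval_continuous :
  continuous (fun p : homeo_plus R * circle R => p.1 p.2).
Proof.
move=> [f x] /= O; rewrite nbhsE /= => -[V [oV Vfx] sO].
have /nbhs_arc[s [t [u [<- stu us fO]]]] :
    nbhs x (f @^-1` V) by apply: homeo_plus_continuous; exact: open_nbhs_nbhs.
exists ([set g : homeo_plus R | g @` (winding @` `[s, u]) `<=` V],
    [set y | cyclic_order (winding s) y (winding u)]) => /=; [split|].
- apply: homeo_plus_compact_open => //.
    by apply: winding_compact; exact: segment_compact.
  by move=> _ [_ [r /= + <-] <-]; rewrite in_itv; exact: fO.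
- apply: open_nbhs_nbhs; split; first exact: open_arc.
  by apply: cyclic_order_winding; lra.
- move=> [g y] /= [gO syu]; apply/sO/gO; exists y => //.
  rewrite -(unwindK s y) in syu *; exists (unwind s y) => //=.
  rewrite in_itv /=.
  by have := cyclic_order_windingP (unwind_itv s y) _ syu; lra.
Qed.

(** One half of the exponential law, by the tube lemma on K. It expresses that the compact-open
    topology is coarser than any topology making evaluation jointly continuous. *)
Lemma continuous_homeo_plus (X : topologicalType) (F : X -> homeo_plus R) :
  continuous (fun p : X * circle R => F p.1 p.2) -> continuous F.
Proof.
move=> cF a; apply: homeo_plus_cvg => K O cK oO FKO.
have /compact_near_coveringP/(_ X (nbhs a) (fun b x => O (F b x))) := cK.
move=> cover; have : \forall b \near a, K `<=` (fun x => O (F b x)).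
  apply: cover => x Kx.
  have OFx : O (F a x) by apply: FKO; exists x.
  have := cF (a, x) O (open_nbhs_nbhs (conj oO OFx)).
  by move=> [[A B] /= [nA nB] AB]; exists (B, A) => // -[y b] /= [By Ab];
    exact: (AB (b, y)).
by apply: filterS => b KO _ [x Kx <-]; exact: KO.
Qed.

Lemma homeo_plus_hausdorff_group :
  hausdorff_group_topology (Topological.class (homeo_plus R)).
Proof.
have ceval x : continuous (fun f : homeo_plus R => f x).
  move=> f; have cfx : (g, x) @[g --> f] --> (f, x).
    have cf : g @[g --> f] --> f by exact: cvg_id.
    have cx : x @[g --> f] --> x by exact: (@cvg_cst _ x _ (nbhs f)).
    exact: cvg_pair cf cx.
  exact: cvg_comp cfx (@homeo_plus_eval_continuous (f, x)).
split=> /=.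
- apply: continuous_homeo_plus => -[[f g] x].
  have cf : p.1.1 @[p --> (f, g, x)] --> f by apply: cvg_comp cvg_fst cvg_fst.
  have cg : p.1.2 @[p --> (f, g, x)] --> g by apply: cvg_comp cvg_fst cvg_snd.
  have cx : p.2 @[p --> (f, g, x)] --> x by exact: cvg_snd.
  have cgx : (p.1.2 : homeo_plus R) p.2 @[p --> (f, g, x)] --> g x.
    exact: cvg_comp (cvg_pair cg cx) (@homeo_plus_eval_continuous (g, x)).
  exact: cvg_comp (cvg_pair cf cgx) (@homeo_plus_eval_continuous (f, g x)).
- move=> f; apply: homeo_plus_cvg => [|K O cK oO fKO].
    by apply: fmap_filter; exact: nbhs_filter.
  (* The inverse of g maps K into O exactly when g maps the complement of O, which is compact, into
     the complement of K, which is open. *)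
  have : \forall g \near f, (g : homeo_plus R) @` (~` O) `<=` ~` K.
    apply: homeo_plus_compact_open.
    + by apply: subclosed_compact circle_compact _ => //; exact: open_closedC.
    + by rewrite openC; exact: compact_closed circle_hausdorff cK.
    + move=> _ [x nOx <-] Kfx; apply: nOx; rewrite -(homeo_plusK f x).
      by apply: fKO; exists (f x).
  apply: filterS => g gO _ [x Kx <-]; apply: contrapT => nO.
  by apply: (gO x) => //; exists ((g^-1)%g x) => //; exact: homeo_plusVK.
- move=> f g fg; apply/homeo_plus_eqP => x.
  exact: continuous_cluster_eq circle_hausdorff (ceval x) fg.
Qed.

(** * Evaluation under an arbitrary Hausdorff group topology, and minimality *)

(** The witnesses are lifted to the line, so that their order relative to other parameters can be
    used. *)
Definition arc_images_meet s u f g : Prop := exists r w,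
  [/\ s < r < u, s < w < u & g (winding r) = f (winding w)].

Lemma near_arc_images_meet (sigma : Topological (homeo_plus R)) f s u :
  hausdorff_group_topology sigma -> s < u < s + 1 ->
  \forall g \near (f : Topological.Pack sigma), arc_images_meet s u f g.
Proof.
move=> hsigma su; have [h [k [hU kU hk]]] := noncommuting_bumps su.
(* Conjugation by f preserves noncommutation, so f k f^-1 can take the role of k in
   [near_noncommuting]. *)
have : (f * h * f^-1 * (f * k * f^-1) <> f * k * f^-1 * (f * h * f^-1))%g.
  by rewrite !mulgA !mulgVK => /mulIg; rewrite -!mulgA => /mulgI.
move=> /(near_noncommuting hsigma).
apply: filterS => g; apply: contra_notP => nrw.
(* If the images of the arc under g and f were disjoint, g h g^-1 and f k f^-1 would have disjoint
   supports and commute. *)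
apply: (disjoint_support_commute hU (B := f @` (winding @` `]s, u[))).
  move=> x; have [|kx] := kU ((f^-1)%g x).
    by left; exists ((f^-1)%g x) => //; exact: homeo_plusVK.
  by right; rewrite !homeo_plusM kx homeo_plusVK.
move=> _ [r /= + <-] [_ [w /= + <-] fwgr]; rewrite !in_itv => sr sw.
by apply: nrw; exists r, w.
Qed.

Lemma hausdorff_group_eval_continuous (sigma : Topological (homeo_plus R)) :
  hausdorff_group_topology sigma ->
  continuous (fun p : Topological.Pack sigma * circle R =>
    (p.1 : homeo_plus R) p.2).
Proof.
move=> hsigma [f x] /= O nO.
have /nbhs_arc[s [t [u [<- stu us fO]]]] :
    nbhs x ((f : homeo_plus R) @^-1` O) by exact: homeo_plus_continuous.
(* The arcs (s, a) and (b, u) flank t; y will range over the arc (a, b) between them. *)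
have [a sat] : exists a, s < a < t by exists ((s + t) / 2); lra.
have [b tbu] : exists b, t < b < u by exists ((t + u) / 2); lra.
have nsa := @near_arc_images_meet sigma f s a hsigma ltac:(lra).
have nbu := @near_arc_images_meet sigma f b u hsigma ltac:(lra).
exists (setI (arc_images_meet s a f) (arc_images_meet b u f),
  [set y | cyclic_order (winding a) y (winding b)]) => /=; [split|].
- exact: filterI nsa nbu.
- apply: open_nbhs_nbhs; split; first exact: open_arc.
  by apply: cyclic_order_winding; lra.
move=> [g y] /= [[[r1 [w1 [sr1 sw1 +]]] [r2 [w2 [sr2 sw2 +]]]]].
rewrite -(unwindK a y); move: (unwind a y) (unwind_itv a y) => r ar e1 e2.
move=> /(cyclic_order_windingP ar)-/(_ ltac:(lra)) arb.
(* Since r1 < r < r2, g sends the three points to a cyclic triple whose ends are the f-images of w1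
   and w2. Applying f^-1 places f^-1 (g y) in the arc from w1 to w2, inside (s, u), and f maps this
   arc into O. *)
have := @cyclic_order_winding _ r1 r r2 ltac:(lra) ltac:(lra) ltac:(lra).
move/(homeo_plus_cyclic_order g); rewrite e1 e2.
move/(homeo_plus_cyclic_order (f^-1)%g); rewrite !homeo_plusK => wzw.
rewrite -(homeo_plusVK f (g _)); move: wzw.
set z := (f^-1)%g _.
rewrite -(unwindK w1 z); move: (unwind w1 z) (unwind_itv w1 z) => v wv.
move=> /(cyclic_order_windingP wv)-/(_ ltac:(lra)) => wvw.
by apply: fO; lra.
Qed.

End HomeoPlusTopology.

Theorem theorem4p5 (R : realType) :
  a_minimal (Topological.class (homeo_plus R)).
Proof.
split=> [|sigma hsigma]; first exact: homeo_plus_hausdorff_group.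
(* Joint continuity of evaluation makes the identity continuous from [sigma] to the compact-open
   topology. *)
have /continuousP cid := @continuous_homeo_plus R (Topological.Pack sigma) id
  (hausdorff_group_eval_continuous hsigma).
by move=> A /cid.
Qed.
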